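(* Let $n\ge1$, let $\lambda=(\lambda_1,\dots,\lambda_n)$ be a partition of length at most $n$ and let $\lambda^{(0)}=(\lambda_2,\dots,\lambda_n)$ be its bottom partition. Let $U=(u_1,\dots,u_{n-1})$ be a sequence of positive real numbers, let $a,b$ be distinct positive real numbers and $t>0$. Then the pseudo-affinity factor of the Müntz space $\mathcal{E}_\lambda(n)$ is given by $$\alpha(U;a,b,t)=\left(\frac{t-a}{b-a}\right)\frac{S_\lambda(U,a,t)\,S_{\lambda^{(0)}}(U,b)}{S_\lambda(U,a,b)\,S_{\lambda^{(0)}}(U,t)},$$ and $$\beta(U;a,b,t)=1-\alpha(U;a,b,t)=\left(\frac{b-t}{b-a}\right)\frac{S_\lambda(U,b,t)\,S_{\lambda^{(0)}}(U,a)}{S_\lambda(U,a,b)\,S_{\lambda^{(0)}}(U,t)}.$$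
   Context: Partitions and Schur functions: a partition of length at most $n$ is a sequence of integers $\lambda_1\ge\dots\ge\lambda_n\ge0$; partitions differing only by trailing zeros are identified. For a partition $\mu$ of length at most $m$, $S_\mu(u_1,\dots,u_m)=\det(u_i^{\mu_j+m-j})_{1\le i,j\le m}/\det(u_i^{m-j})_{1\le i,j\le m}$ is the Schur polynomial (evaluated also at coinciding arguments). Müntz space: $\mathcal{E}_\lambda(n)=\mathrm{span}(1,\phi_1,\dots,\phi_n)$ on $I=\,]0,\infty[$, where $\phi=(\phi_1,\dots,\phi_n)^T$ with $\phi(t)=(t^{\lambda_1-\lambda_2+1},t^{\lambda_1-\lambda_3+2},\dots,t^{\lambda_1-\lambda_n+(n-1)},t^{\lambda_1+n})^T$. Chebyshev blossom: let $\mathrm{Osc}_i\phi(t)=\{\phi(t)+\alpha_1\phi'(t)+\dots+\alpha_i\phi^{(i)}(t):\alpha_j\in\mathbb{R}\}$. For a tuple $(u_1,\dots,u_n)\in I^n$ consisting, up to order, of distinct points $\tau_1,\dots,\tau_r$ with multiplicities $\mu_1,\dots,\mu_r$ ($\sum\mu_k=n$), the blossom value $\varphi(u_1,\dots,u_n)\in\mathbb{R}^n$ is the unique point of $\bigcap_{k=1}^r\mathrm{Osc}_{n-\mu_k}\phi(\tau_k)$. Pseudo-affinity factor: for $U=(u_1,\dots,u_{n-1})\in I^{n-1}$, distinct $a,b\in I$ and $t\in I$, $\alpha(U;a,b,t)$ is the real number such that $\varphi(u_1,\dots,u_{n-1},t)=(1-\alpha(U;a,b,t))\,\varphi(u_1,\dots,u_{n-1},a)+\alpha(U;a,b,t)\,\varphi(u_1,\dots,u_{n-1},b)$.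 *)

(* Defs.v *)
From HB Require Import structures.
From mathcomp Require Import all_boot all_order all_algebra.
From mathcomp Require Import all_classical all_reals all_analysis.
(* The notations of multinomials clash with those of MathComp-Analysis. *)
From mathcomp Require Import -(notations) monalg mpoly.

Set Implicit Arguments.
Unset Strict Implicit.
Unset Printing Implicit Defensive.

Import Order.TTheory GRing.Theory Num.Theory.
Import numFieldNormedType.Exports.

Local Open Scope classical_set_scope.
Local Open Scope ring_scope.

(* A partition is a nonincreasing sequence of naturals padded with zeros:
   its (j+1)-st part is [nth 0 mu j], so trailing zeros are irrelevant. *)
Definition is_partition (mu : seq nat) : bool := sorted geq mu.

(* det (X_i ^ (mu_j + m - j)), 1 <= i, j <= m; with 0-based j the exponent
   m - j reads m - j.+1.  For mu = 0 this is the Vandermonde determinant. *)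
Definition alternant (R : realType) (m : nat) (mu : seq nat) : mpoly m R :=
  \det (\matrix_(i < m, j < m)
          (mpolyX R (mnm1 i)) ^+ (nth 0%N mu j + (m - j.+1))).

(* The quotient of alternants is taken in the polynomial ring, so that it can
   be evaluated at coinciding arguments.  That ring is a domain and the
   Vandermonde determinant is nonzero, hence the quotient is unique. *)
Definition schur_poly (R : realType) (m : nat) (mu : seq nat) : mpoly m R :=
  xget 0 [set p | p * alternant R m [::] = alternant R m mu].

(* S_mu(u_1, ..., u_m), where m is the size of u. *)
Definition schur (R : realType) (mu : seq nat) (u : seq R) : R :=
  meval (fun i : 'I_(size u) => u`_i) (schur_poly R (size u) mu).

(* Coordinates are 0-based: the exponent of coordinate k is
   lambda_1 - lambda_(k+2) + (k+1).  The last one, k = n-1, is lambda_1 + n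
   because lambda_(n+1) = 0. *)
Definition muntz_curve (R : realType) (n : nat) (lam : seq nat) (t : R) :
    'cV[R]_n :=
  \col_(k < n) t ^+ (nth 0%N lam 0 - nth 0%N lam k.+1 + k.+1).

Definition osc (R : realType) (n : nat) (lam : seq nat) (i : nat) (t : R) :
    set 'cV[R]_n :=
  [set x | exists c : nat -> R,
     x = muntz_curve n lam t
         + \sum_(1 <= j < i.+1) c j *: derive1n j (@muntz_curve R n lam) t].

(* p is the unique common point of the flats Osc_(n - mu_k)(tau_k), tau_k
   ranging over the distinct entries of u and mu_k being its multiplicity. *)
Definition is_blossom_value (R : realType) (n : nat) (lam : seq nat)
    (u : seq R) (p : 'cV[R]_n) : Prop :=
  \bigcap_(tau in [set` u]) osc lam (n - count_mem tau u)%N tau = [set p].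

(* alpha is the unique real number such that
   phi(U, t) = (1 - alpha) phi(U, a) + alpha phi(U, b), the three blossom
   values being well defined. *)
Definition is_pseudo_affinity_factor (R : realType) (n : nat) (lam : seq nat)
    (U : seq R) (a b t alpha : R) : Prop :=
  exists pa pb pt : 'cV[R]_n,
    [/\ is_blossom_value lam (rcons U a) pa,
        is_blossom_value lam (rcons U b) pb,
        is_blossom_value lam (rcons U t) pt &
        [set al : R | pt = (1 - al) *: pa + al *: pb] = [set alpha]].

Definition pseudo_affinity_factor (R : realType) (n : nat) (lam : seq nat)
    (U : seq R) (a b t : R) : R :=
  xget 0 [set alpha | is_pseudo_affinity_factor n lam U a b t alpha].

(* Main.v *)
Require Import Defs.
From HB Require Import structures.
From mathcomp Require Import all_boot all_order all_algebra.
From mathcomp Require Import all_classical all_reals all_analysis.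
From mathcomp Require Import -(notations) monalg mpoly.
From mathcomp Require Import ring zify.

Set Implicit Arguments.
Unset Strict Implicit.
Unset Printing Implicit Defensive.

Import Order.TTheory GRing.Theory Num.Theory.
Import numFieldNormedType.Exports.

Local Open Scope classical_set_scope.
Local Open Scope ring_scope.

(** Put e_k = lam_1 - lam_(k+1) + k and m_k = lam_(k+1) + n - k for
    0 <= k <= n, so that e_0 = 0, the curve has coordinates t^e_1, ..., t^e_n,
    and m_k + e_k does not depend on k.  Let w_k be the product of the
    (e_k - e_l)^-1 over l <> k, so that sum_k w_k f(e_k) is the divided
    difference of f at e_0, ..., e_n.  To a point p of R^n, with the extra
    coordinate p_0 = 1, attach the sparse polynomial
      P_p(X) = sum_k w_k p_k X^m_k.
    The proof rests on four facts.

    - Duality ([osc_dvdP]).  The point p lies in the osculating flat of order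
      n - mu at tau exactly when (X - tau)^mu divides P_p.  Indeed the flat
      consists of the points p_k = q(e_k) tau^e_k with deg q <= n - mu, and the
      derivatives of P_p of order < mu at tau are divided differences of q
      times polynomials of degree < mu ([divided_difference_order]).  Hence the
      flats of u_1, ..., u_n meet in the points p for which
      prod_i (X - u_i) divides P_p ([blossomP]).

    - Newton interpolation.  The coefficients of X^e in the Newton basis with
      nodes u ([newton_coef]) are polynomial in u, make sense at coinciding
      nodes, and their determinant is, up to sign, the quotient of an alternant
      by the Vandermonde determinant; this evaluates a Schur polynomial at any
      point ([schurE]).

    - Cramer's rule ([fewnomial_schur]).  If prod_i (X - u_i) * q has only the
      exponents m_k, with leading coefficient c, then
      q(x) S_lam0(u) = c S_lam(u, x), where lam0 is the bottom partition.

    - Descartes' rule of signs ([fewnomial_pos_roots]).  A nonzero polynomial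
      with n terms has fewer than n positive roots, counted with multiplicity.
      So Schur polynomials do not vanish at positive arguments
      ([schur_neq0]), and blossom values exist and are unique.

    For y > 0 let P_y = prod_(u in U) (X - u) * (X - y) * Q_y be the polynomial
    of the blossom value at (U, y).  As p |-> P_p is affine and injective, the
    factor alpha is given by
      (X - t) Q_t = (1 - alpha) (X - a) Q_a + alpha (X - b) Q_b.
    Evaluation at a expresses alpha through Q_t(a) and Q_b(a), evaluation at b
    expresses 1 - alpha through Q_t(b) and Q_a(b), and Cramer's rule turns these
    values into Schur functions.  Conversely the alpha so obtained works: the
    difference of the two sides vanishes at a and, multiplied by
    prod_(u in U) (X - u), has n terms and n positive roots, hence is 0. *)

(** * Newton interpolation *)

Definition newton_poly {A : comNzRingType} (u : nat -> A) (k : nat) :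
  {poly A} := \prod_(l < k) ('X - (u l)%:P).

(** The coefficient of 'X^e on the i-th Newton polynomial, that is the divided
    difference of x^e at u_0, ..., u_i.  The recursion is Leibniz' rule for
    multiplication by 'X; it involves no division, so nodes may coincide and
    ring morphisms commute with it. *)
Fixpoint newton_coef {A : comNzRingType} (u : nat -> A) (e i : nat) : A :=
  match e with
  | 0 => (i == 0%N)%:R
  | e'.+1 =>
      u i * newton_coef u e' i
      + (if i is i'.+1 then newton_coef u e' i' else 0)
  end.

Definition newton_mx {A : comNzRingType} (u : nat -> A) (n : nat)
    (e : nat -> nat) : 'M[A]_n :=
  \matrix_(i < n, j < n) newton_coef u (e j) i.

Section NewtonRing.
Context {A : comNzRingType}.
Implicit Types (u c : nat -> A).

Lemma newton_coef_gt u e i : (e < i)%N -> newton_coef u e i = 0.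
Proof.
elim: e i => [|e IH] [|i] //= lt_ei.
by rewrite !IH ?mulr0 ?addr0 // ltnW.
Qed.

Lemma newton_coef_diag u e : newton_coef u e e = 1.
Proof. by elim: e => //= e ->; rewrite newton_coef_gt // mulr0 add0r. Qed.

Lemma newton_coef_ext u v e i : (forall l, (l <= i)%N -> u l = v l) ->
  newton_coef u e i = newton_coef v e i.
Proof.
elim: e i => [|e IH] i uv //=; rewrite uv // (IH i) //; congr (_ + _).
by case: i uv => // i uv; apply: IH => l le_li; apply/uv/leqW.
Qed.

Lemma size_newton_poly u k : size (newton_poly u k) = k.+1.
Proof.
rewrite /newton_poly -(big_mkord xpredT (fun l => 'X - (u l)%:P)).
by rewrite size_prod_XsubC size_iota subn0.
Qed.

Lemma newton_poly_seq u (s : seq A) :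
  (forall i, (i < size s)%N -> u i = nth 0 s i) ->
  newton_poly u (size s) = \prod_(y <- s) ('X - y%:P).
Proof.
by move=> us; rewrite (big_nth 0) big_mkord; apply: eq_bigr => i _; rewrite us.
Qed.

(** Multiplying N_i by 'X gives u_i N_i + N_(i+1), which is the recursion of
    [newton_coef]. *)
Lemma Xn_newton u e n : (e < n)%N ->
  'X^e = \sum_(i < n) newton_coef u e i *: newton_poly u i.
Proof.
elim: e n => [|e IH] [|n] // lt_en.
  rewrite big_ord_recl /= scale1r /newton_poly big_ord0 big1 ?addr0 //.
  by move=> i _; rewrite scale0r.
rewrite exprS (IH n) // mulr_sumr /=.
under [RHS]eq_bigr do rewrite scalerDl.
rewrite big_split /= big_ord_recr /= newton_coef_gt // mulr0 scale0r addr0.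
rewrite [X in _ = _ + X]big_ord_recl /= scale0r add0r -big_split /=.
apply: eq_bigr => i _.
rewrite /bump leq0n add1n /newton_poly big_ord_recr /= -scalerAr.
rewrite mulrBr scalerBr ['X * _]mulrC [_ * _%:P]mulrC mul_polyC scalerA.
by rewrite [newton_coef _ _ _ * _]mulrC addrC subrK.
Qed.

(** The Newton polynomials of index at least m are multiples of the m-th, and
    all the cofactors but the first vanish at u_m. *)
Lemma newton_sum_split u (b : nat -> A) m n :
  (forall i, (i < m)%N -> b i = 0) ->
  exists r : {poly A},
    \sum_(i < n) b i *: newton_poly u i = newton_poly u m * r
    /\ ((m < n)%N -> r.[u m] = b m).
Proof.
move=> b0; case: (leqP n m) => [le_nm|lt_mn].
  exists 0; split=> //; rewrite mulr0 big1 // => i _.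
  by rewrite b0 ?scale0r // (leq_trans (ltn_ord i)).
have [p ->] : exists p, n = (m + p.+1)%N.
  by exists (n - m).-1; rewrite prednK ?subnKC ?subn_gt0 // ltnW.
exists (\sum_(l < p.+1) b (m + l)%N *: \prod_(i < l) ('X - (u (m + i)%N)%:P)).
rewrite big_split_ord /= big1 ?add0r; last first.
  by move=> i _; rewrite b0 ?scale0r.
split=> [|_].
  rewrite mulr_sumr; apply: eq_bigr => l _; rewrite -scalerAr; congr (_ *: _).
  by rewrite /newton_poly big_split_ord.
rewrite horner_sum big_ord_recl /= big_ord0 hornerZ hornerC mulr1 addn0.
rewrite big1 ?addr0 // => l _; rewrite hornerZ big_ord_recl hornerM /=.
by rewrite addn0 hornerXsubC subrr mul0r mulr0.
Qed.

(** Exponents and coefficients are indexed by all naturals, so that an exponent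
    sequence can be shifted or restricted without casts. *)
Definition fewnomial (n : nat) (e : nat -> nat) c : {poly A} :=
  \sum_(j < n) c j *: 'X^(e j).

Lemma fewnomial_newton u n (e : nat -> nat) c m : exists2 N, (m < N)%N &
  fewnomial n e c =
    \sum_(i < N) (\sum_(j < n) newton_coef u (e j) i * c j) *: newton_poly u i.
Proof.
pose N := (m.+1 + (\max_(j < n) e j).+1)%N; exists N; first exact: leq_addr.
under [RHS]eq_bigr do rewrite scaler_suml.
rewrite exchange_big; apply: eq_bigr => j _ /=.
rewrite (@Xn_newton u _ N); last first.
  by rewrite /N addnS ltnS (leq_trans _ (leq_addl _ _)) // (leq_bigmax j).
by rewrite scaler_sumr; apply: eq_bigr => i _; rewrite scalerA mulrC.
Qed.

Lemma newton_poly_lreg u m : GRing.lreg (newton_poly u m).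
Proof. by apply: monic_lreg; apply: monic_prod_XsubC. Qed.

(** Together with [newton_dvd_fewnomial], this turns divisibility by the m-th
    Newton polynomial into m linear equations on the coefficients c; the next
    Newton coefficient is then the value of the quotient at u_m. *)
Lemma fewnomial_quotient u n (e : nat -> nat) c m (q : {poly A}) :
  fewnomial n e c = newton_poly u m * q ->
  (forall i, (i < m)%N -> \sum_(j < n) newton_coef u (e j) i * c j = 0)
  /\ \sum_(j < n) newton_coef u (e j) m * c j = q.[u m].
Proof.
elim: m q => [|m IH] q.
  have [N lt_N ->] := fewnomial_newton u n e c 0.
  pose b i := \sum_(j < n) newton_coef u (e j) i * c j.
  have b0 i : (i < 0)%N -> b i = 0 by [].
  have [r [-> /(_ lt_N) rE]] := newton_sum_split u N b0.
  by move=> /newton_poly_lreg <-; split=> //; rewrite rE.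
move=> fE; have fE' : fewnomial n e c = newton_poly u m * (('X - (u m)%:P) * q).
  by rewrite fE /newton_poly big_ord_recr mulrA.
have [b0 bm] := IH _ fE'.
rewrite hornerM hornerXsubC subrr mul0r in bm.
have {}b0 i : (i < m.+1)%N -> \sum_(j < n) newton_coef u (e j) i * c j = 0.
  by rewrite ltnS leq_eqVlt => /predU1P[->|/b0].
split=> //; move: fE.
have [N lt_N ->] := fewnomial_newton u n e c m.+1.
have [r [-> /(_ lt_N) rE]] := newton_sum_split u N b0.
by move=> /newton_poly_lreg <-; rewrite rE.
Qed.

Lemma newton_dvd_fewnomial u n (e : nat -> nat) c m :
  (forall i, (i < m)%N -> \sum_(j < n) newton_coef u (e j) i * c j = 0) ->
  exists q, fewnomial n e c = newton_poly u m * q.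
Proof.
move=> b0; have [N _ ->] := fewnomial_newton u n e c 0.
by have [r [-> _]] := newton_sum_split u N b0; exists r.
Qed.
End NewtonRing.

(** With the exponents n - 1, ..., 0 the matrix is antitriangular with 1 on the
    antidiagonal, hence the sign. *)
Lemma det_newton_mx0 {A : comNzRingType} (u : nat -> A) n :
  \det (newton_mx u n (fun j => n - j.+1)%N) = (-1) ^+ 'C(n, 2).
Proof.
elim: n => [|n IH]; first by rewrite det_mx00.
rewrite (expand_det_row _ ord_max) big_ord_recl big1 => [|j _].
  rewrite addr0 mxE subn1 newton_coef_diag mul1r binS bin1 addnC exprD -IH.
  rewrite /cofactor addn0; congr (_ * \det _).
  apply/matrixP=> i j; have lt_in : (i < n)%N := ltn_ord i.
  by rewrite !mxE /= /bump [(n <= i)%N]leqNgt lt_in.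
have lt_jn : (j < n)%N := ltn_ord j.
by rewrite mxE newton_coef_gt ?mul0r //= /bump leq0n; lia.
Qed.

Lemma newton_mx_map {A B : comNzRingType} (f : {rmorphism A -> B})
    (u : nat -> A) n (e : nat -> nat) :
  map_mx f (newton_mx u n e) = newton_mx (f \o u) n e.
Proof.
apply/matrixP=> i j; rewrite !mxE; elim: (e j) (i : nat) => [|k IH] i' /=.
  by case: i' => [|i'] /=; rewrite ?rmorph1 ?rmorph0.
by case: i' => [|i'] /=; rewrite rmorphD rmorphM !IH ?rmorph0.
Qed.

(** The collocation matrix factors through the Newton basis: the values of the
    Newton polynomials at the nodes form a lower triangular matrix, whose
    determinant is the Vandermonde product. *)
Lemma det_vandermonde_newton {A : comNzRingType} (u : nat -> A) n
    (e : nat -> nat) :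
  \det (\matrix_(i < n, j < n) u i ^+ e j)
  = (\prod_(i < n) (newton_poly u i).[u i]) * \det (newton_mx u n e).
Proof.
pose L : 'M[A]_n := \matrix_(i < n, k < n) (newton_poly u k).[u i].
have L_trig : is_trig_mx L.
  apply/is_trig_mxP => i k lt_ik; rewrite mxE /newton_poly horner_prod.
  by rewrite (bigD1 (Ordinal lt_ik)) //= hornerXsubC subrr mul0r.
have -> : \prod_(i < n) (newton_poly u i).[u i] = \det L.
  by rewrite det_trig //; apply: eq_bigr => i _; rewrite mxE.
rewrite -det_mulmx; congr (\det _); apply/matrixP => i j; rewrite !mxE.
under eq_bigr do rewrite !mxE.
rewrite -[u i ^+ e j]hornerXn.
rewrite (@Xn_newton _ u _ (n + (e j).+1)) ?leq_addl // horner_sum.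
rewrite big_split_ord /= [X in _ + X]big1 ?addr0.
  by apply: eq_bigr => k _; rewrite hornerZ mulrC.
move=> k _; rewrite hornerZ /newton_poly horner_prod.
have lt_i : (i < n + k)%N by rewrite ltn_addr.
by rewrite (bigD1 (Ordinal lt_i)) //= hornerXsubC subrr mul0r mulr0.
Qed.

(** Exchanging the last two nodes u_n and u_(n+1) changes only the divided
    differences over u_0, ..., u_n, by (u_(n+1) - u_n) times those over all
    nodes: a row operation. *)
Lemma det_newton_mx_transp {A : comNzRingType} (u : nat -> A) n
    (e : nat -> nat) :
  let v i := if i == n then u n.+1 else if i == n.+1 then u n else u i in
  \det (newton_mx v n.+2 e) = \det (newton_mx u n.+2 e).
Proof.
move=> v.
pose i0 : 'I_n.+2 := inord n.
have i0E : i0 = n :> nat by rewrite inordK.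
pose T : 'M[A]_n.+2 := 1%:M + (u n.+1 - u n) *: delta_mx i0 ord_max.
have T_det : \det T^T = 1.
  rewrite det_trig; last first.
    apply/is_trig_mxP => i j lt_ij; rewrite !mxE -!val_eqE /= i0E.
    have := ltn_ord j; have -> : (j == i :> nat) = false by lia.
    by case: eqP => [jn|]; case: eqP => [iN|]; rewrite /= ?mulr0 ?addr0 //; lia.
  rewrite big1 // => i _; rewrite !mxE eqxx -!val_eqE /= i0E.
  case: eqP => [->|]; rewrite ?andbF /= ?mulr0 ?addr0 //.
  by rewrite ltn_eqF // mulr0 addr0.
rewrite -[RHS]mul1r -T_det det_tr -det_mulmx; congr (\det _).
apply/matrixP=> i j; rewrite mulmxDl mul1mx -scalemxAl !mxE (bigD1 ord_max) //=.
rewrite big1 ?addr0 => [|k ne_k]; last first.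
  by rewrite !mxE (negPf ne_k) andbF mul0r.
rewrite !mxE eqxx andbT -val_eqE /= i0E.
move: (e j) => {j}e.
have lt_v k l : (l < n)%N -> newton_coef v k l = newton_coef u k l.
  move=> lt_l; apply: newton_coef_ext => i' le_i'.
  by rewrite /v !ltn_eqF // (leq_ltn_trans le_i') // ltnW.
suff [vn vn1] : newton_coef v e n =
    newton_coef u e n + (u n.+1 - u n) * newton_coef u e n.+1
    /\ newton_coef v e n.+1 = newton_coef u e n.+1.
  case: eqP => [->|ne_in]; first by rewrite mul1r.
  rewrite mul0r mulr0 addr0.
  have [lt_in|] := ltnP i n; first exact: lt_v.
  move=> le_ni; have -> // : i = n.+1 :> nat.
  by have := ltn_ord i; lia.
elim: e => [|e [IHn IHn1]] /=; first by rewrite mulr0 addr0.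
have vnE : v n = u n.+1 by rewrite /v eqxx.
have vn1E : v n.+1 = u n by rewrite /v eqxx gtn_eqF.
rewrite vnE vn1E IHn IHn1; split; last by ring.
case: n @v {i0 i0E T T_det i IHn1 vnE vn1E} lt_v IHn => [|n] v lt_v IHn;
  last rewrite lt_v //; ring.
Qed.

(** * Schur polynomials as determinants of divided differences *)

Section Schur.
Context {R : realType}.

(** The variables of [mpoly m R], padded with 0 just as [nth 0 s] pads a
    sequence [s] of values: evaluation turns one into the other. *)
Definition mvar (m i : nat) : mpoly m R :=
  if insub i is Some k then mpolyX R (mnm1 k) else 0.

Lemma mvarE m (i : 'I_m) : mvar m i = mpolyX R (mnm1 i).
Proof. by rewrite /mvar valK. Qed.

Lemma alternant_newton m (mu : seq nat) :
  alternant R m mu = (\prod_(i < m) (newton_poly (mvar m) i).[mvar m i])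
    * \det (newton_mx (mvar m) m (fun j => nth 0%N mu j + (m - j.+1))%N).
Proof.
rewrite -det_vandermonde_newton; congr (\det _); apply/matrixP=> i j.
by rewrite !mxE mvarE.
Qed.

(** Both alternants contain the same Vandermonde product, which is nonzero in
    the polynomial ring; dividing it out leaves determinants of Newton
    coefficients. *)
Lemma schur_polyE m (mu : seq nat) :
  schur_poly R m mu = (-1) ^+ 'C(m, 2) *
    \det (newton_mx (mvar m) m (fun j => nth 0%N mu j + (m - j.+1))%N).
Proof.
have a0E := alternant_newton m [::].
rewrite [X in _ * \det X](_ : _ =
    newton_mx (mvar m) m (fun j => m - j.+1)%N) in a0E;
  last by apply/matrixP => i j; rewrite !mxE nth_nil.
rewrite det_newton_mx0 in a0E.
have nz : \prod_(i < m) (newton_poly (mvar m) i).[mvar m i] != 0.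
  apply/prodf_neq0 => i _; rewrite /newton_poly horner_prod.
  apply/prodf_neq0 => l _; rewrite hornerXsubC subr_eq0.
  rewrite mvarE -[l : nat]/(nat_of_ord (widen_ord (ltnW (ltn_ord i)) l)) mvarE.
  apply/eqP => /(congr1 (mcoeff (mnm1 i))).
  rewrite !mcoeffX !eq_mnm1 eqxx -val_eqE /= ltn_eqF //.
  by move/eqP; rewrite oner_eq0.
have sgnK : (-1) ^+ 'C(m, 2) * (-1) ^+ 'C(m, 2) = 1 :> mpoly m R.
  by rewrite -expr2 sqrr_sign.
apply: xget_unique => /= [|q qE].
  by rewrite a0E alternant_newton mulrCA [X in _ * X = _]mulrAC sgnK mul1r.
apply: (mulIf (x := alternant R m [::])).
  by rewrite a0E mulf_neq0 // signr_eq0.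
rewrite qE a0E alternant_newton [RHS]mulrCA [X in _ = _ * X]mulrAC.
by rewrite sgnK mul1r.
Qed.

(** Newton coefficients commute with evaluation, so the formula holds at
    coinciding arguments as well. *)
Lemma schurE (mu : seq nat) (u : seq R) :
  schur mu u = (-1) ^+ 'C(size u, 2) *
    \det (newton_mx (nth 0 u) (size u)
            (fun j => nth 0%N mu j + (size u - j.+1))%N).
Proof.
rewrite /schur schur_polyE rmorphM rmorphXn rmorphN rmorph1 -det_map_mx.
rewrite newton_mx_map; congr (_ * \det (newton_mx _ _ _)).
apply/funext => i /=; rewrite /mvar; case: insubP => [k _ <-|].
  exact: mevalXU.
by rewrite -leqNgt => le_i; rewrite rmorph0 nth_default.
Qed.

Lemma schur_transp (mu : seq nat) (s : seq R) x y :
  schur mu (s ++ [:: x; y]) = schur mu (s ++ [:: y; x]).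
Proof.
rewrite !schurE !size_cat /= addn2 -det_newton_mx_transp /=.
congr (_ * \det (newton_mx _ _ _)); apply/funext => i; rewrite !nth_cat.
rewrite ltnn subnn ltnNge leqnSn subSnn /=.
case: ltngtP => [lt_i|lt_i|->]; rewrite ?subnn //=.
  by rewrite ltn_eqF // ltnW.
case: eqP => [->|ne_i]; first by rewrite subSnn.
by rewrite !nth_default //=; lia.
Qed.

(** The Newton coefficients of the left-hand side at the nodes (s, x) are
    0, ..., 0, q(x).  Cramer's rule for the first unknown c_0 of this linear
    system gives the identity, because removing the last node and the first
    exponent turns lam into its bottom partition. *)
Lemma fewnomial_schur (lam : seq nat) (s : seq R) (c : nat -> R)
    (q : {poly R}) x :
  fewnomial (size s).+1 (fun j => nth 0%N lam j + (size s - j))%N c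
    = (\prod_(y <- s) ('X - y%:P)) * q ->
  q.[x] * schur (behead lam) s = c 0%N * schur lam (rcons s x).
Proof.
set n := size s; set e := (fun j => _) => Fq.
pose v := nth 0 (rcons s x).
have vs i : (i < n)%N -> v i = nth 0 s i.
  by move=> lt_in; rewrite /v nth_rcons lt_in.
rewrite -(newton_poly_seq vs) in Fq.
have [b0 bn] := fewnomial_quotient Fq.
pose M := newton_mx v n.+1 e.
have MC : M *m \col_(j < n.+1) c j = q.[x] *: delta_mx ord_max 0.
  apply/matrixP => i j; rewrite !mxE (ord1 j) eqxx andbT.
  under eq_bigr do rewrite !mxE.
  have [->|ne_i] := eqVneq i ord_max.
    by rewrite mulr1 /= bn /v nth_rcons ltnn eqxx.
  rewrite mulr0 b0 // ltn_neqAle -ltnS ltn_ord andbT.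
  by apply: contraNneq ne_i => iE; apply/eqP/val_inj.
(* The first unknown of the system, solved by Cramer's rule. *)
have := congr1 (fun A => (\adj M *m A) 0 0) MC.
rewrite mulmxA mul_adj_mx mul_scalar_mx -scalemxAr -colE !mxE /cofactor /=.
rewrite addn0.
have -> : row' ord_max (col' 0 M) =
    newton_mx (nth 0 s) n (fun j => nth 0%N (behead lam) j + (n - j.+1))%N.
  apply/matrixP => i j; have lt_in : (i < n)%N := ltn_ord i.
  rewrite !mxE /= /bump [(n <= i)%N]leqNgt lt_in nth_behead /e add0n add1n.
  by apply: newton_coef_ext => l le_li; rewrite vs // (leq_ltn_trans le_li).
rewrite !schurE size_rcons -/n binS bin1 exprD => cM.
rewrite [RHS]mulrCA -[X in _ = _ * X]mulrC.
rewrite (_ : \det (newton_mx _ n.+1 _) * c 0%N = \det M * c 0%N) //.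
rewrite cM; set S1 := (-1) ^+ n; set S2 := (-1) ^+ 'C(n, 2).
have S1K : S1 * S1 = 1 by rewrite -expr2 sqrr_sign.
rewrite -[LHS]mulr1 -S1K; ring.
Qed.
End Schur.

(** * Descartes' rule of signs *)

(** Only lower bounds on numbers of sign changes are compared, so a chain of
    witnesses, read from left to right, replaces the count of sign changes. *)
Fixpoint alternates {R : numDomainType} (f : nat -> R) (b : bool)
    (lo k : nat) : Prop :=
  if k is k'.+1 then
    exists i, [/\ (lo <= i)%N, 0 < (-1) ^+ b * f i
               & alternates f (~~ b) i.+1 k']
  else True.

Section Descartes.
Context {R : realDomainType}.
Implicit Types (f : nat -> R) (p q : {poly R}).

Lemma alternates_widen f b lo lo' k :
  (lo' <= lo)%N -> alternates f b lo k -> alternates f b lo' k.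
Proof.
by case: k => //= k le_lo [i [lo_i ? ?]]; exists i; rewrite (leq_trans le_lo).
Qed.

Lemma alternates_support f b lo k : alternates f b lo k ->
  exists s, [/\ size s = k, uniq s
              & all (fun i => (lo <= i)%N && (f i != 0)) s].
Proof.
elim: k b lo => [|k IH] b lo /=; first by exists [::].
move=> [i [lo_i fi /IH[s [<- s_uniq /allP s_f]]]]; exists (i :: s); split=> //=.
  by rewrite s_uniq andbT; apply/negP => /s_f; rewrite ltnn.
rewrite lo_i /=; apply/andP; split.
  by apply: contraTneq fi => ->; rewrite mulr0 ltxx.
apply/allP => j /s_f /andP[lt_ij ->]; rewrite andbT.
by rewrite (leq_trans lo_i) // ltnW.
Qed.

Lemma first_from (P : pred nat) lo i : (lo <= i)%N -> P i ->
  exists j, [/\ (lo <= j <= i)%N, P j & (lo == j) || ~~ P j.-1].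
Proof.
elim: i => [|i IH]; first by rewrite leqn0 => /eqP-> P0; exists 0%N.
move=> lo_i Pi; have [lo_eq|ne_lo] := eqVneq lo i.+1.
  by exists i.+1; rewrite lo_i leqnn lo_eq eqxx.
have {}lo_i : (lo <= i)%N by lia.
have [/(IH lo_i)[j [/andP[lo_j j_i] Pj Pj1]]|nPi] := boolP (P i).
  by exists j; rewrite lo_j Pj Pj1 leqW.
by exists i.+1; rewrite Pi nPi orbT leqnn leqW.
Qed.

(** With f the coefficients of p, the function f_(i-1) - a f_i lists those of
    ('X - a) p.  At the first index where f takes an expected sign, that
    function has the opposite sign, because f_(i-1) does not have the expected
    one.  It has one more term, of the sign of the last f_i of the alternation,
    at the first later index where f loses that sign; such an index exists
    because f is eventually 0.  The hypothesis on [prev lo] starts the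
    induction; it is strict when no alternation is left, where only the last
    argument applies. *)
Lemma alternates_diff f (a : R) (b : bool) lo k N :
  let prev (i : nat) := if i == 0%N then 0 else f i.-1 in
  0 < a -> (forall i, (N <= i)%N -> f i = 0) ->
  (if k is 0 then (-1) ^+ b * prev lo < 0 else (-1) ^+ b * prev lo <= 0) ->
  alternates f b lo k ->
  alternates (fun i => prev i - a * f i) (~~ b) lo k.+1.
Proof.
move=> prev a_gt0 fN.
have signN (c : bool) x : (-1) ^+ (~~ c) * x = - ((-1) ^+ c * x) :> R.
  by case: c; rewrite /= ?mulN1r ?opprK ?mul1r.
have prevE lo' j : lo' != j -> (lo' <= j)%N -> prev j = f j.-1.
  by rewrite /prev; case: j => //; rewrite leqn0 => /negPf->.
elim: k b lo => [|k IH] b lo.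
  move=> lt0 _.
  have [||j [/andP[lo_j _] fj fj1]] :=
      @first_from (fun i => 0 <= (-1) ^+ b * f i) lo (lo + N).
  - exact: leq_addr.
  - by rewrite fN ?mulr0 // leq_addl.
  exists j; split=> //=; rewrite signN mulrBr oppr_gt0 subr_lt0 mulrCA.
  apply: lt_le_trans (mulr_ge0 (ltW a_gt0) fj).
  have [<- //|ne_j] := eqVneq lo j.
  by rewrite (negPf ne_j) -ltNge in fj1; rewrite (prevE lo).
move=> le0 [i [lo_i fi alt_f]].
have [||j [/andP[lo_j le_ji] fj fj1]] :=
    @first_from (fun i => 0 < (-1) ^+ b * f i) lo i; [by []|by []|].
exists j; split=> //.
  rewrite signN mulrBr oppr_gt0 subr_lt0 mulrCA.
  apply: le_lt_trans (mulr_gt0 a_gt0 fj).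
  have [<- //|ne_j] := eqVneq lo j.
  by rewrite (negPf ne_j) -leNgt in fj1; rewrite (prevE lo).
apply: (@alternates_widen _ _ i.+1); first by rewrite ltnS.
apply: IH alt_f; rewrite signN oppr_lt0 oppr_le0 (ltW fi) fi.
by case: (k).
Qed.

(** Each positive root adds a sign change. *)
Lemma alternates_prod (s : seq R) q : all (fun x => 0 < x) s -> q != 0 ->
  exists b, alternates (nth 0 (\prod_(x <- s) ('X - x%:P) * q)) b 0 (size s).+1.
Proof.
move=> + q0; elim: s => [_|a s IH /= /andP[a_gt0 /IH[b alt_b]]].
  rewrite big_nil mul1r; exists (lead_coef q < 0);
  exists (size q).-1; split=> //.
  by rewrite -/(lead_coef q) -normrEsign normr_gt0 lead_coef_eq0.
set p := \prod_(x <- s) _ * q in alt_b.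
exists (~~ b); rewrite big_cons -mulrA -/p.
suff -> : nth 0 (('X - a%:P) * p) =
    (fun i => (if i == 0%N then 0 else p`_i.-1) - a * p`_i).
  apply: (@alternates_diff (nth 0 p) a b 0 (size s).+1 (size p)) => //=.
  by move=> i; apply: nth_default.
by apply/funext => i; rewrite mulrBl coefB coefXM mul_polyC coefZ.
Qed.

(** A polynomial with n terms has at most n coefficients of alternating signs,
    whereas n positive roots of a nonzero one force n + 1 of them. *)
Lemma fewnomial_pos_roots (s : seq R) n (e : nat -> nat) (c : nat -> R) q :
  all (fun x => 0 < x) s -> (n <= size s)%N ->
  fewnomial n e c = \prod_(x <- s) ('X - x%:P) * q -> q = 0.
Proof.
move=> s_gt0 le_ns fE; have [//|/(alternates_prod s_gt0)[b]] := eqVneq q 0.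
rewrite -fE => /alternates_support[t [t_size t_uniq /allP t_f]].
suff : (size t <= size (map e (iota 0 n)))%N.
  by rewrite t_size size_map size_iota ltnNge le_ns.
apply: uniq_leq_size => // i /t_f /= fi_neq0; apply: contraNT fi_neq0 => i_e.
rewrite coef_sum big1 // => j _; rewrite coefZ coefXn.
case: eqP => [ij|]; last by rewrite mulr0.
by case/negP: i_e; rewrite ij map_f // mem_iota add0n ltn_ord.
Qed.

Lemma coef_fewnomial n (e : nat -> nat) (c : nat -> R) j :
  {in gtn n &, injective e} -> (j < n)%N -> (fewnomial n e c)`_(e j) = c j.
Proof.
move=> e_inj lt_jn; rewrite coef_sum (bigD1 (Ordinal lt_jn)) //= big1 ?addr0.
  by rewrite coefZ coefXn eqxx mulr1.
move=> k ne_kj; rewrite coefZ coefXn.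
case: eqP => [eq_e|]; last by rewrite mulr0.
case/eqP: ne_kj; apply/val_inj/esym/e_inj => //=.
exact: ltn_ord.
Qed.

(** A vector in the kernel would give a nonzero polynomial with as many
    terms as positive roots. *)
Lemma det_newton_mx_neq0 (s : seq R) (e : nat -> nat) :
  all (fun x => 0 < x) s -> {in gtn (size s) &, injective e} ->
  \det (newton_mx (nth 0 s) (size s) e) != 0.
Proof.
move=> s_gt0 e_inj; rewrite -det_tr; apply/det0P => -[w w_neq0 wM].
pose c j := if insub j is Some k then w 0 k else 0.
have cE (j : 'I_(size s)) : c j = w 0 j by rewrite /c valK.
have [i lt_i|q fE] := @newton_dvd_fewnomial _ (nth 0 s) (size s) e c (size s).
  transitivity ((w *m (newton_mx (nth 0 s) (size s) e)^T) 0 (Ordinal lt_i)).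
    by rewrite mxE; apply: eq_bigr => j _; rewrite !mxE cE mulrC.
  by rewrite wM mxE.
rewrite newton_poly_seq // in fE.
have q0 := fewnomial_pos_roots s_gt0 (leqnn _) fE.
rewrite q0 mulr0 in fE; case/eqP: w_neq0; apply/rowP => j.
by rewrite mxE -cE -(coef_fewnomial c e_inj) // fE coef0.
Qed.
End Descartes.

(** * Divided differences and multiplicities *)

Lemma dvdp_prod_XsubC_count {F : fieldType} (s : seq F) (p : {poly F}) :
  {in s, forall x, ('X - x%:P) ^+ count_mem x s %| p}
  <-> \prod_(x <- s) ('X - x%:P) %| p.
Proof.
split=> [|dvd_p x _]; last first.
  apply: dvdp_trans dvd_p; rewrite (bigID (pred1 x)) /=.
  rewrite (eq_bigr (fun=> 'X - x%:P)) => [|y /eqP-> //].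
  by rewrite big_const_seq iter_mulr_1 dvdp_mulr.
elim: s p => [|a s IH] p dvd_p; first by rewrite big_nil dvd1p.
have /dvdpP[p' pE] : 'X - a%:P %| p.
  apply: dvdp_trans (dvd_p a (mem_head _ _)) => /=.
  by rewrite eqxx exprS dvdp_mulIl.
rewrite big_cons pE mulrC dvdp_mul2r ?polyXsubC_eq0 //; apply: IH => x x_s.
have := dvd_p x; rewrite inE x_s orbT pE /= => /(_ isT).
have [->|ne_ax] := eqVneq a x.
  by rewrite exprS mulrC dvdp_mul2r ?polyXsubC_eq0.
by rewrite add0n Gauss_dvdpl // coprimep_expl // coprimep_XsubC2 // subr_eq0.
Qed.

Section DividedDifference.
Context {F : fieldType}.
Variables (n : nat) (x : nat -> F).
Hypothesis x_inj : {in gtn n.+1 &, injective x}.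

(** The weights of the divided difference at x_0, ..., x_n. *)
Definition dd_weight (k : nat) : F :=
  \prod_(l < n.+1 | l != k :> nat) (x k - x l)^-1.

Let basis (k : nat) : {poly F} :=
  \prod_(l < n.+1 | l != k :> nat) ('X - (x l)%:P).

Definition interpolant (y : nat -> F) : {poly F} :=
  \sum_(k < n.+1) (y k * dd_weight k) *: basis k.

Let size_basis (k : 'I_n.+1) : size (basis k) = n.+1.
Proof.
rewrite /basis -big_filter size_prod_XsubC; congr _.+1.
transitivity #|[pred l : 'I_n.+1 | l != k]|; first by rewrite cardE.
by rewrite cardC1 card_ord.
Qed.

Lemma dd_weight_neq0 k : (k < n.+1)%N -> dd_weight k != 0.
Proof.
move=> lt_k; apply/prodf_neq0 => l ne_lk; rewrite invr_eq0 subr_eq0.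
by apply: contraNneq ne_lk => /x_inj ->//; rewrite inE ltn_ord.
Qed.

Lemma size_interpolant y : (size (interpolant y) <= n.+1)%N.
Proof.
apply: (leq_trans (size_sum _ _ _)); apply/bigmax_leqP => k _.
by rewrite (leq_trans (size_scale_leq _ _)) // size_basis.
Qed.

Lemma interpolantE y k : (k < n.+1)%N -> (interpolant y).[x k] = y k.
Proof.
move=> lt_k; rewrite horner_sum (bigD1 (Ordinal lt_k)) //= big1 ?addr0.
  rewrite hornerZ horner_prod -mulrA -big_split /= big1 ?mulr1 // => l ne_lk.
  rewrite hornerXsubC mulVf // subr_eq0.
  by apply: contraNneq ne_lk => /x_inj ->//; rewrite inE ltn_ord.
move=> l ne_lk; rewrite hornerZ horner_prod (bigD1 (Ordinal lt_k)) /=.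
  by rewrite hornerXsubC subrr mul0r mulr0.
by rewrite eq_sym.
Qed.

Lemma interpolant_unique (f : {poly F}) :
  (size f <= n.+1)%N -> interpolant (fun k => f.[x k]) = f.
Proof.
move=> size_f; apply/eqP; rewrite -subr_eq0; apply/eqP.
apply: (@roots_geq_poly_eq0 _ _ (map x (iota 0 n.+1))).
- apply/allP => y /mapP[k]; rewrite mem_iota => lt_k ->.
  by rewrite rootE hornerD hornerN interpolantE ?subrr.
- rewrite map_inj_in_uniq ?iota_uniq // => k l.
  by rewrite !mem_iota => lt_k lt_l; apply: x_inj.
- rewrite size_map size_iota (leq_trans (size_polyD _ _)) // geq_max.
  by rewrite size_interpolant size_polyN.
Qed.

(** Compare the coefficients of 'X^n in Lagrange's interpolation formula, whose
    basis polynomials are monic of degree n. *)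
Lemma divided_difference (f : {poly F}) : (size f <= n.+1)%N ->
  \sum_(k < n.+1) dd_weight k * f.[x k] = f`_n.
Proof.
move=> /interpolant_unique {2}<-; rewrite coef_sum; apply: eq_bigr => k _.
have /monicP : basis k \is monic by apply: monic_prod => l _; apply: monicXsubC.
by rewrite coefZ lead_coefE size_basis => ->; rewrite mulr1 mulrC.
Qed.
End DividedDifference.

Section OscDual.
Context {F : fieldType}.

(** The falling factorial, seen as the Newton polynomial with nodes
    0, ..., j - 1, so that [newton_expansion] applies to it. *)
Definition ffact_poly (j : nat) : {poly F} := newton_poly (fun l => l%:R) j.

Lemma ffact_polyE j (e : nat) : (ffact_poly j).[e%:R] = (e ^_ j)%:R.
Proof.
elim: j => [|j IH]; first by rewrite /ffact_poly /newton_poly big_ord0 hornerC.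
rewrite /ffact_poly /newton_poly big_ord_recr hornerM /= IH hornerXsubC.
rewrite ffactnSr natrM.
have [le_je|lt_ej] := leqP j e; first by rewrite natrB.
by rewrite ffact_small // !mul0r.
Qed.

Lemma newton_expansion (u : nat -> F) (q : {poly F}) N : (size q <= N)%N ->
  exists b : nat -> F, q = \sum_(j < N) b j *: newton_poly u j.
Proof.
move=> size_q; exists (fun j => \sum_(e < size q) q`_e * newton_coef u e j).
under eq_bigr do rewrite scaler_suml.
rewrite exchange_big /= -{1}[q]coefK poly_def.
apply: eq_bigr => e _; rewrite (@Xn_newton _ u _ N) ?(leq_trans _ size_q) //.
by rewrite scaler_sumr; apply: eq_bigr => j _; rewrite scalerA.
Qed.
End OscDual.

(** As k varies, the falling factorial of m_k = E - e_k is the value at e_k of a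
    polynomial of degree i, so the sum is the coefficient of degree n of a
    product of degree i + deg q.  It vanishes for degree reasons if deg q is
    small enough; otherwise the index i = n - deg q makes it a product of
    leading coefficients. *)
Lemma divided_difference_order {F : numFieldType} (n E mu : nat)
    (e m : nat -> nat) (q : {poly F}) :
  {in gtn n.+1 &, injective e} ->
  (forall k, (k < n.+1)%N -> (m k + e k)%N = E) ->
  (mu <= n.+1)%N -> (size q <= n.+1)%N ->
  (forall i, (i < mu)%N -> \sum_(k < n.+1)
     dd_weight n (fun l => (e l)%:R) k * ((m k ^_ i)%:R * q.[(e k)%:R]) = 0)
  <-> (size q <= n.+1 - mu)%N.
Proof.
move=> e_inj meE le_mu size_q.
have er_inj : {in gtn n.+1 &, injective (fun l => (e l)%:R : F)}.
  by move=> k l ltk ltl /eqP; rewrite eqr_nat => /eqP; apply: e_inj.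
pose G i : {poly F} := ffact_poly i \Po (E%:R%:P - 'X).
have size_aff : size (E%:R%:P - 'X : {poly F}) = 2%N.
  by rewrite -opprB size_polyN size_XsubC.
have size_G i : size (G i) = i.+1.
  have : size (ffact_poly i : {poly F}) = i.+1.
    exact: size_newton_poly.
  have := size_comp_poly (ffact_poly i : {poly F}) (E%:R%:P - 'X).
  rewrite size_aff muln1 => GE fE; rewrite fE /= -/(G i) in GE.
  suff : (0 < size (G i))%N by move=> /prednK <-; rewrite GE.
  rewrite size_poly_gt0 comp_poly2_eq0 ?size_aff //.
  by rewrite -size_poly_gt0 fE.
have sumE (i : nat) : (size (q * G i)%R <= n.+1)%N -> \sum_(k < n.+1)
     dd_weight n (fun l => (e l)%:R) k * ((m k ^_ i)%:R * q.[(e k)%:R])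
   = (q * G i)`_n.
  move=> /(divided_difference er_inj) <-; apply: eq_bigr => k _.
  rewrite hornerM horner_comp hornerD hornerN hornerC hornerX -(meE k) //.
  rewrite natrD addrK ffact_polyE.
  by rewrite [_ * q.[_]]mulrC.
split=> [sum0|size_q' i lt_i]; last first.
  have size_qG : (size (q * G i)%R <= n)%N.
    by rewrite (leq_trans (size_polyMleq _ _)) // size_G; lia.
  by rewrite sumE ?nth_default // leqW.
rewrite leqNgt; apply/negP => lt_size.
have q_neq0 : q != 0 by rewrite -size_poly_gt0; lia.
have G_neq0 i : G i != 0 by rewrite -size_poly_gt0 size_G.
pose i := (n.+1 - size q)%N.
have size_qG : size (q * G i)%R = n.+1.
  by rewrite size_mul // size_G addnS /= /i subnKC.
have lt_i : (i < mu)%N by rewrite /i; lia.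
have leadE : lead_coef (q * G i) = (q * G i)`_n by rewrite lead_coefE size_qG.
have /eqP := sum0 i lt_i; rewrite sumE ?size_qG // -leadE lead_coef_eq0.
by rewrite mulf_eq0 (negPf q_neq0) (negPf (G_neq0 i)).
Qed.

(** * The Muntz curve and its dual polynomials *)

Definition muntz_exp (lam : seq nat) (k : nat) : nat :=
  (nth 0 lam 0 - nth 0 lam k + k)%N.

Definition dual_exp (n : nat) (lam : seq nat) (k : nat) : nat :=
  (nth 0 lam k + (n - k))%N.

(** Affine coordinates completed by a coordinate 1 of index 0, which belongs to
    the constant function t^0 of the Muntz space. *)
Definition homog {R : nzRingType} {n} (x : 'cV[R]_n) (k : nat) : R :=
  if k is k'.+1 then (if insub k' is Some i then x i 0 else 0) else 1.

Lemma homogS {R : nzRingType} n (x : 'cV[R]_n) (i : 'I_n) :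
  homog x i.+1 = x i 0.
Proof. by rewrite /homog valK. Qed.

(** The function of the Muntz space that vanishes to order n at u is, up to
    scaling, the divided difference of e |-> (x / u)^e at the exponents, with
    coefficients w_k u^(-e_k).  It defines the osculating hyperplane at u, and
    its value at the point x is the dual polynomial of x evaluated at u, up to a
    power of u. *)
Definition dual_poly {R : numFieldType} (n : nat) (lam : seq nat)
    (x : 'cV[R]_n) : {poly R} :=
  fewnomial n.+1 (dual_exp n lam)
    (fun k => dd_weight n (fun l => (muntz_exp lam l)%:R) k * homog x k).

Lemma partition_nth (mu : seq nat) k l : is_partition mu -> (k <= l)%N ->
  (nth 0 mu l <= nth 0 mu k)%N.
Proof.
move=> mu_part le_kl.
have [lt_l|ge_l] := ltnP l (size mu); last by rewrite nth_default.
apply: (sorted_leq_nth (leT := geq)) => //.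
- by move=> a b c /= ba ac; apply: leq_trans ac ba.
- by move=> a /=; apply: leqnn.
- by rewrite inE (leq_ltn_trans le_kl).
Qed.

Section Partition.
Context (n : nat) (lam : seq nat).
Hypothesis hlam : is_partition lam.

Lemma muntz_exp_inj : injective (muntz_exp lam).
Proof.
move=> k l; wlog le_kl : k l / (k <= l)%N => [wlg|].
  by move=> eq_e; case/orP: (leq_total k l) => le; [|symmetry]; apply: wlg.
have := partition_nth hlam le_kl; have := partition_nth hlam (leq0n k).
by rewrite /muntz_exp; lia.
Qed.

Lemma dual_muntz_exp k :
  (k < n.+1)%N -> (dual_exp n lam k + muntz_exp lam k)%N = (nth 0 lam 0 + n)%N.
Proof.
by have := partition_nth hlam (leq0n k); rewrite /dual_exp /muntz_exp; lia.
Qed.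

Lemma dual_exp_inj : {in gtn n.+1 &, injective (dual_exp n lam)}.
Proof.
move=> k l ltk ltl eq_d; apply: muntz_exp_inj.
by have := dual_muntz_exp ltk; have := dual_muntz_exp ltl; lia.
Qed.
End Partition.

Section Osculating.
Context {R : realType} (n : nat) (lam : seq nat).
Hypothesis hlam : is_partition lam.
Implicit Types (x : 'cV[R]_n) (t : R).

Lemma derive1n_muntz j : derive1n j (@muntz_curve R n lam) =
  fun t => \col_(k < n) ((muntz_exp lam k.+1 ^_ j)%:R
                         * t ^+ (muntz_exp lam k.+1 - j)).
Proof.
have der c d t :
    is_derive t 1 (fun s : R => c * s ^+ d) (c * (d%:R * t ^+ d.-1)).
  have -> : (fun s : R => c * s ^+ d) = c \*: (id ^+ d).
    by apply/funext => s /=; rewrite exprfctE.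
  by apply: is_derive_eq; rewrite /= scaler1.
elim: j => [|j IH].
  rewrite derive1n0; apply/funext => t; apply/matrixP => k l.
  by rewrite !mxE ffactn0 mul1r subn0.
rewrite derive1nS IH; apply/funext => t; rewrite derive1E derive_mx.
  apply/matrixP => k l; rewrite !mxE.
  under eq_fun do rewrite mxE.
  have /@derive_val -> :=
    der (muntz_exp lam k.+1 ^_ j)%:R (muntz_exp lam k.+1 - j)%N t.
  by rewrite ffactnSr natrM mulrA subnS.
apply/derivable_mxP => k l.
under eq_fun do rewrite mxE.
by have /@ex_derive :=
  der (muntz_exp lam k.+1 ^_ j)%:R (muntz_exp lam k.+1 - j)%N t.
Qed.

(** The j-th derivative of t^e is t^(-j) times the falling factorial of e times
    t^e, so a combination of derivatives is t^e times a polynomial in e, and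
    falling factorials form a basis of polynomials.  The coordinate of index 0
    normalizes the coefficient of the curve itself to 1. *)
Lemma osc_polyP i t x : 0 < t ->
  osc lam i t x <-> exists2 q : {poly R}, (size q <= i.+1)%N &
    forall k, (k < n.+1)%N ->
      homog x k = q.[(muntz_exp lam k)%:R] * t ^+ muntz_exp lam k.
Proof.
move=> t_gt0; have t_neq0 : t != 0 by rewrite gt_eqF.
have e0 : muntz_exp lam 0 = 0%N by rewrite /muntz_exp subnn.
have powE (e j : nat) :
    (e ^_ j)%:R * t ^+ (e - j) = t ^- j * ((e ^_ j)%:R * t ^+ e).
  have [le_je|lt_ej] := leqP j e; last by rewrite ffact_small // !mul0r mulr0.
  rewrite mulrCA; congr (_ * _).
  by rewrite expfB_cond ?(negPf t_neq0) ?add0n // mulrC.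
have oscE (c : nat -> R) k : (muntz_curve n lam t
      + \sum_(1 <= j < i.+1) c j *: derive1n j (@muntz_curve R n lam) t) k 0
   = \sum_(j < i.+1) (if j == 0 :> nat then 1 else c j) * (t ^- j
       * ((muntz_exp lam k.+1 ^_ j)%:R * t ^+ muntz_exp lam k.+1)).
  rewrite big_ord_recl /= ffactn0 mul1r invr1 !mul1r 2!mxE; congr (_ + _).
  rewrite summxE big_add1 -pred_Sn big_mkord; apply: eq_bigr => j _.
  by rewrite derive1n_muntz !mxE powE.
split=> [[c ->]|[q size_q qE]].
  pose b (j : nat) := (if j == 0%N then 1 else c j) * t ^- j.
  exists (\sum_(j < i.+1) b j *: ffact_poly j).
    apply: (leq_trans (size_sum _ _ _)); apply/bigmax_leqP => j _.
    rewrite (leq_trans (size_scale_leq _ _)) //.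
    by rewrite size_newton_poly.
  case=> [_|k lt_k].
    rewrite e0 mulr1 /= horner_sum big_ord_recl [X in _ + X]big1 => [|j _].
      by rewrite hornerZ ffact_polyE ffactn0 /b /= invr1 !mulr1 addr0.
    by rewrite hornerZ ffact_polyE mulr0.
  rewrite -[k]/(nat_of_ord (Ordinal (lt_k : (k < n)%N))) homogS oscE.
  rewrite horner_sum mulr_suml.
  by apply: eq_bigr => j _; rewrite hornerZ ffact_polyE /b !mulrA.
have [b qb] := newton_expansion (fun l => l%:R) size_q.
exists (fun j => b j * t ^+ j); apply/matrixP => k l; rewrite (ord1 l) oscE.
have b0 : b 0%N = 1.
  have := qE 0%N isT; rewrite e0 mulr1 qb horner_sum.
  rewrite big_ord_recl [X in _ + X]big1 => [|j _].
    by rewrite hornerZ ffact_polyE ffactn0 mulr1 addr0.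
  by rewrite hornerZ ffact_polyE mulr0.
rewrite -homogS qE ?ltnS // qb horner_sum mulr_suml; apply: eq_bigr => j _.
rewrite hornerZ ffact_polyE mulrA.
have -> : (if j == 0 :> nat then 1 else b j * t ^+ j) = b j * t ^+ j.
  by case: eqP => // ->; rewrite b0 mulr1.
by rewrite mulrA mulfK // expf_neq0.
Qed.

Lemma newton_coef_const t m i :
  newton_coef (fun=> t) m i = 'C(m, i)%:R * t ^+ (m - i).
Proof.
elim: m i => [|m IH] [|i] /=; rewrite ?bin0 ?mul1r ?mul0r ?addr0 //.
  by rewrite IH bin0 mul1r -exprS subn0.
rewrite !IH binS natrD mulrDl subSS; congr (_ + _).
have [lt_im|le_mi] := ltnP i m; last by rewrite bin_small // !mul0r mulr0.
by rewrite mulrCA -exprS -subSn // subSS.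
Qed.

(** Let q interpolate the numbers x_k t^(-e_k) at the e_k.  By [osc_polyP],
    osculation bounds the degree of q.  By [divided_difference_order] so does
    the vanishing of the divided differences of q times falling factorials of
    m_k, and these are, up to nonzero factors, the Newton coefficients of the
    dual polynomial when all nodes equal t. *)
Lemma osc_dvdP mu t x : 0 < t -> (mu <= n)%N ->
  osc lam (n - mu) t x <-> ('X - t%:P) ^+ mu %| dual_poly lam x.
Proof.
move=> t_gt0 le_mu; have t_neq0 : t != 0 by rewrite gt_eqF.
set e := muntz_exp lam.
have e_inj : {in gtn n.+1 &, injective (fun l => (e l)%:R : R)}.
  by move=> k l _ _ /eqP; rewrite eqr_nat => /eqP; apply: muntz_exp_inj.
pose q := interpolant n (fun l => (e l)%:R) (fun k => homog x k * t ^- e k).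
have qE k : (k < n.+1)%N -> homog x k = q.[(e k)%:R] * t ^+ e k.
  by move=> lt_k; rewrite /q (interpolantE e_inj) // mulfVK // expf_neq0.
have size_q : (size q <= n.+1)%N by apply: size_interpolant.
have oscE : osc lam (n - mu) t x <-> (size q <= n.+1 - mu)%N.
  rewrite osc_polyP // subSn //; split=> [[q' size_q' q'E]|]; last by exists q.
  rewrite (_ : q = q') // -(interpolant_unique e_inj (f := q')).
    apply: eq_bigr => k _; congr (_ * _ *: _).
    by rewrite q'E // mulfK // expf_neq0.
  by rewrite (leq_trans size_q') // ltnS leq_subr.
rewrite oscE.
rewrite -(@divided_difference_order _ n (nth 0 lam 0 + n) mu e
            (dual_exp n lam)) //; first last.
- exact: leqW.
- by move=> k lt_k; apply: dual_muntz_exp.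
- by move=> k l _ _; apply: muntz_exp_inj.
have newtonE : newton_poly (fun=> t) mu = ('X - t%:P) ^+ mu.
  by rewrite /newton_poly prodr_const card_ord.
pose c k := dd_weight n (fun l => (e l)%:R) k * homog x k.
have sumE i : (i`!)%:R * t ^+ i
    * \sum_(j < n.+1) newton_coef (fun=> t) (dual_exp n lam j) i * c j
  = t ^+ (nth 0 lam 0 + n) * \sum_(k < n.+1)
     dd_weight n (fun l => (e l)%:R) k
       * ((dual_exp n lam k ^_ i)%:R * q.[(e k)%:R]).
  rewrite !mulr_sumr; apply: eq_bigr => k _.
  rewrite /c qE // -(dual_muntz_exp hlam (ltn_ord k)) exprD newton_coef_const.
  rewrite -bin_ffact natrM.
  have [le_i|lt_i] := leqP i (dual_exp n lam k); last first.
    by rewrite bin_small // !(mul0r, mulr0).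
  have -> : t ^+ dual_exp n lam k = t ^+ i * t ^+ (dual_exp n lam k - i).
    by rewrite -exprD subnKC.
  by rewrite -/e; ring.
have nz1 i : (i`!)%:R * t ^+ i != 0 :> R.
  by rewrite mulf_neq0 ?expf_neq0 // pnatr_eq0 -lt0n fact_gt0.
have nz2 : t ^+ (nth 0 lam 0 + n) != 0 by rewrite expf_neq0.
split=> [sum0|/dvdpP[r]].
  have [i lt_i|r] :=
      @newton_dvd_fewnomial _ (fun=> t) n.+1 (dual_exp n lam) c mu.
    by apply: (mulfI (nz1 i)); rewrite sumE sum0 // !mulr0.
  by rewrite /dual_poly => ->; rewrite newtonE dvdp_mulIl.
rewrite mulrC -newtonE => /fewnomial_quotient[sum0 _] i lt_i.
by apply: (mulfI nz2); rewrite -sumE sum0 // !mulr0.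
Qed.
End Osculating.

(** * Blossom values and the pseudo-affinity factor *)

Lemma schur_neq0 {R : realType} (mu : seq nat) (s : seq R) :
  is_partition mu -> all (fun x => 0 < x) s -> schur mu s != 0.
Proof.
move=> mu_part s_gt0; rewrite schurE mulf_neq0 ?signr_eq0 //.
apply: det_newton_mx_neq0 => // k l; rewrite !inE.
wlog le_kl : k l / (k <= l)%N => [wlg ltk ltl eq_e|].
  by case/orP: (leq_total k l) => le; [|symmetry]; apply: wlg.
by have := partition_nth mu_part le_kl => /= ? ? ?; lia.
Qed.

Section Blossom.
Context {R : realType} (n : nat) (lam : seq nat).
Hypothesis hlam : is_partition lam.
Implicit Types (p x : 'cV[R]_n) (u : seq R).

Let w (k : nat) : R := dd_weight n (fun l => (muntz_exp lam l)%:R) k.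

Let w_neq0 k : (k < n.+1)%N -> w k != 0.
Proof.
apply: dd_weight_neq0 => i j _ _ /eqP; rewrite eqr_nat => /eqP.
exact: muntz_exp_inj.
Qed.

Lemma blossomP u p : size u = n -> all (fun y => 0 < y) u ->
  is_blossom_value lam u p
  <-> forall x, \prod_(y <- u) ('X - y%:P) %| dual_poly lam x <-> x = p.
Proof.
move=> size_u /allP u_gt0.
have bigcapE x : (\bigcap_(tau in [set` u])
      osc lam (n - count_mem tau u)%N tau) x
    <-> \prod_(y <- u) ('X - y%:P) %| dual_poly lam x.
  rewrite -dvdp_prod_XsubC_count; split=> H tau tau_u;
    have := H tau tau_u; rewrite osc_dvdP ?u_gt0 // -size_u; exact: count_size.
split=> [/seteqP[sub sup] x|pE].
  by rewrite -bigcapE; split=> [/sub|->] //; apply: sup.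
by apply/seteqP; split=> x; [move/bigcapE/pE|move/pE/bigcapE].
Qed.

Lemma blossom_unique u p p' :
  is_blossom_value lam u p -> is_blossom_value lam u p' -> p' = p.
Proof.
by rewrite /is_blossom_value => -> /seteqP[_ /(_ p' erefl)].
Qed.

(** Divisibility amounts to n linear equations on the n coordinates, once the
    leading coefficient is fixed; the matrix has the exponents m_1, ..., m_n and
    is invertible by Descartes' rule. *)
Lemma blossom_exists u : size u = n -> all (fun y => 0 < y) u ->
  exists p, is_blossom_value lam u p.
Proof.
move=> size_u u_gt0; set v := nth 0 u; set m := dual_exp n lam.
pose D := newton_mx v n (fun j => m j.+1).
have D_unit : D \in unitmx.
  rewrite unitmxE unitfE /D -size_u det_newton_mx_neq0 // size_u => k l ltk ltl.
  by move=> /(@dual_exp_inj n lam hlam k.+1 l.+1 ltk ltl) [].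
pose z := invmx D *m \col_(i < n) - (newton_coef v (m 0%N) i * w 0).
exists (\col_(j < n) ((w j.+1)^-1 * z j 0)); rewrite blossomP // => x.
pose c k := w k * homog x k.
have cE : \prod_(y <- u) ('X - y%:P) %| dual_poly lam x <->
    D *m (\col_(j < n) (w j.+1 * x j 0))
      = \col_(i < n) - (newton_coef v (m 0%N) i * w 0).
  have sumE (i : 'I_n) : \sum_(j < n.+1) newton_coef v (m j) i * c j =
      newton_coef v (m 0%N) i * w 0
      + (D *m (\col_(j < n) (w j.+1 * x j 0))) i 0.
    rewrite big_ord_recl /c mulr1; congr (_ + _); rewrite !mxE.
    by apply: eq_bigr => j _; rewrite !mxE /= /bump add1n -homogS.
  have prodE : newton_poly v n = \prod_(y <- u) ('X - y%:P).
    by rewrite -size_u newton_poly_seq.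
  split=> [/dvdpP[q]|DE].
    rewrite mulrC -prodE => /fewnomial_quotient[sum0 _].
    apply/matrixP => i j; rewrite (ord1 j) [RHS]mxE; apply/eqP.
    by rewrite -addr_eq0 addrC -sumE sum0.
  have [i lt_i|q] := @newton_dvd_fewnomial _ v n.+1 m c n.
    by rewrite -[i]/(nat_of_ord (Ordinal lt_i)) sumE DE mxE subrr.
  by rewrite prodE /dual_poly => ->; apply: dvdp_mulIl.
rewrite cE; split=> [/(canRL (mulKmx D_unit)) xE|->].
  apply/matrixP => j k; rewrite (ord1 k) mxE /z -xE mxE mulKf //.
  exact: (w_neq0 (k := j.+1) (ltn_ord j)).
rewrite -[RHS](mulKVmx D_unit); congr (_ *m _).
apply/matrixP => j k; rewrite (ord1 k) mxE [X in _ * X]mxE mulVKf //.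
exact: (w_neq0 (k := j.+1) (ltn_ord j)).
Qed.

Lemma dual_poly_affine al x y :
  dual_poly lam ((1 - al) *: x + al *: y)
  = (1 - al) *: dual_poly lam x + al *: dual_poly lam y.
Proof.
rewrite /dual_poly /fewnomial !scaler_sumr -big_split; apply: eq_bigr => k _ /=.
rewrite !scalerA -scalerDl; congr (_ *: _).
suff -> : homog ((1 - al) *: x + al *: y) k
    = (1 - al) * homog x k + al * homog y k by ring.
case: k => -[|k] lt_k /=; first by ring.
by rewrite (insubT (fun k => k < n)%N (lt_k : (k < n)%N)) !mxE.
Qed.

Section PseudoAffine.
Variable U : seq R.
Hypotheses (size_U : (size U).+1 = n) (U_gt0 : all (fun y => 0 < y) U).

Implicit Types (a b t y z al : R) (pa pb pt : 'cV[R]_n).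

Let all_rcons_gt0 y : 0 < y -> all (fun z => 0 < z) (rcons U y).
Proof. by rewrite all_rcons U_gt0 => ->. Qed.

(** The leading coefficient of a dual polynomial is w 0 for every point, which
    makes the right-hand side explicit. *)
Lemma blossom_quotient y p : 0 < y -> is_blossom_value lam (rcons U y) p ->
  exists2 q : {poly R},
    dual_poly lam p = \prod_(z <- U) ('X - z%:P) * (('X - y%:P) * q)
    & forall z, q.[z] * schur (behead lam) (rcons U y)
                = w 0 * schur lam (rcons (rcons U y) z).
Proof.
move=> y_gt0; rewrite blossomP ?size_rcons ?all_rcons_gt0 //.
move=> /(_ p)[_ /(_ erefl)/dvdpP[q qE]]; rewrite mulrC in qE.
exists q; first by rewrite qE -cats1 big_cat big_seq1 mulrA.
move=> z; rewrite -[w 0]mulr1.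
apply: (fewnomial_schur (c := fun k => w k * homog p k)).
by rewrite size_rcons size_U -qE.
Qed.

(** Let r be the difference of the cofactors of the product over U in the dual
    polynomials of the two sides; the second equation says r(a) = 0.  The
    leading coefficients cancel in that difference, so if r(a) = 0 it has n
    terms and the n positive roots (U, a), and vanishes. *)
Lemma pseudo_affinityP a b t pa pb pt (qa qb qt : {poly R}) al :
  0 < a -> 0 < t -> is_blossom_value lam (rcons U t) pt ->
  dual_poly lam pa = \prod_(z <- U) ('X - z%:P) * (('X - a%:P) * qa) ->
  dual_poly lam pb = \prod_(z <- U) ('X - z%:P) * (('X - b%:P) * qb) ->
  dual_poly lam pt = \prod_(z <- U) ('X - z%:P) * (('X - t%:P) * qt) ->
  pt = (1 - al) *: pa + al *: pb
  <-> (a - t) * qt.[a] = al * ((a - b) * qb.[a]).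
Proof.
move=> a_gt0 t_gt0 pt_blossom.
set V := \prod_(z <- U) _ => Ea Eb Et.
pose r : {poly R} := (1 - al) *: (('X - a%:P) * qa) + al *: (('X - b%:P) * qb)
                     - ('X - t%:P) * qt.
have rE : dual_poly lam ((1 - al) *: pa + al *: pb) - dual_poly lam pt = V * r.
  by rewrite dual_poly_affine Ea Eb Et /r !mulrDr mulrN -!scalerAr.
have raE : r.[a] = al * ((a - b) * qb.[a]) - (a - t) * qt.[a].
  rewrite /r !(hornerD, hornerN, hornerZ, hornerM, hornerX, hornerC).
  by rewrite subrr mul0r mulr0 add0r.
suff -> : pt = (1 - al) *: pa + al *: pb <-> r.[a] = 0.
  by rewrite raE; split=> [/eqP|->]; rewrite ?subrr // subr_eq0 => /eqP.
split=> [ptE|/eqP ra0].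
  have : V * r = 0 by rewrite -rE -ptE subrr.
  have V_neq0 : V != 0 by rewrite monic_neq0 // monic_prod_XsubC.
  by move/eqP; rewrite mulf_eq0 (negPf V_neq0) => /eqP->; rewrite horner0.
have [r' r'E] : exists r', r = ('X - a%:P) * r'.
  by move/factor_theorem: ra0 => [r' ->]; exists r'; rewrite mulrC.
have : fewnomial n (fun k => dual_exp n lam k.+1)
    (fun k => w k.+1 * (homog ((1 - al) *: pa + al *: pb) k.+1 - homog pt k.+1))
  = \prod_(z <- rcons U a) ('X - z%:P) * r'.
  rewrite -cats1 big_cat big_seq1 -mulrA -r'E -rE /dual_poly /fewnomial.
  rewrite !big_ord_recl opprD addrACA subrr add0r -sumrB.
  by apply: eq_bigr => k _; rewrite -scalerBl -mulrBr.
move=> /fewnomial_pos_roots r'0.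
move: rE; rewrite r'E r'0 ?size_rcons ?size_U ?all_rcons_gt0 //.
rewrite !mulr0 => /eqP; rewrite subr_eq0 => /eqP dualE.
move/blossomP: pt_blossom; rewrite size_rcons all_rcons_gt0 //.
move=> /(_ size_U isT) ptP.
symmetry; apply/ptP; rewrite dualE Et -cats1 big_cat big_seq1 mulrA.
exact: dvdp_mulIl.
Qed.
End PseudoAffine.

End Blossom.

Theorem theorem4 (R : realType) (n : nat) (hn : (1 <= n)%N)
    (lam : n.-tuple nat) (hlam : is_partition lam)
    (U : n.-1.-tuple R) (hU : forall u : R, u \in U -> 0 < u)
    (a b t : R) (ha : 0 < a) (hb : 0 < b) (hab : a != b) (ht : 0 < t) :
  [/\ is_pseudo_affinity_factor n lam U a b t
        (pseudo_affinity_factor n lam U a b t),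
      pseudo_affinity_factor n lam U a b t
        = (t - a) / (b - a)
          * ((schur lam (U ++ [:: a; t]) * schur (behead lam) (U ++ [:: b]))
             / (schur lam (U ++ [:: a; b]) * schur (behead lam) (U ++ [:: t])))
    & 1 - pseudo_affinity_factor n lam U a b t
        = (b - t) / (b - a)
          * ((schur lam (U ++ [:: b; t]) * schur (behead lam) (U ++ [:: a]))
             / (schur lam (U ++ [:: a; b])
                * schur (behead lam) (U ++ [:: t])))].
Proof.
have size_U : (size U).+1 = n by rewrite size_tuple prednK.
have U_gt0 : all (fun y => 0 < y) U by apply/allP.
have behead_part : is_partition (behead lam).
  move: hlam; rewrite /is_partition; case: (tval lam) => //= x s.
  exact: path_sorted.
have pos2 y z : 0 < y -> 0 < z -> all (fun x => 0 < x) (U ++ [:: y; z]).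
  by rewrite all_cat U_gt0 /= => -> ->.
have S_neq0 y z : 0 < y -> 0 < z -> schur lam (U ++ [:: y; z]) != 0.
  by move=> y0 z0; rewrite schur_neq0 ?pos2.
have S0_neq0 y : 0 < y -> schur (behead lam) (U ++ [:: y]) != 0.
  by move=> y0; rewrite schur_neq0 // all_cat U_gt0 /= y0.
have blossom y : 0 < y -> exists p, is_blossom_value (n := n) lam (rcons U y) p.
  move=> y0; apply: blossom_exists => //; first by rewrite size_rcons.
  by rewrite all_rcons y0.
have [pa pa_val] := blossom a ha.
have [pb pb_val] := blossom b hb.
have [pt pt_val] := blossom t ht.
have [qa Ea qaE] := blossom_quotient hlam size_U U_gt0 ha pa_val.
have [qb Eb qbE] := blossom_quotient hlam size_U U_gt0 hb pb_val.
have [qt Et qtE] := blossom_quotient hlam size_U U_gt0 ht pt_val.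
set w0 := dd_weight _ _ _ in qaE qbE qtE.
have w0_neq0 : w0 != 0.
  apply: dd_weight_neq0 => // i j _ _ /eqP; rewrite eqr_nat => /eqP.
  exact: muntz_exp_inj.
have rcons2 y z : rcons (rcons U y) z = U ++ [:: y; z].
  by rewrite -!cats1 -catA.
pose S y z := schur lam (U ++ [:: y; z]).
pose S0 y := schur (behead lam) (U ++ [:: y]).
have SC y z : S y z = S z y by apply: schur_transp.
have valE q y x : 0 < y -> q.[x] * schur (behead lam) (rcons U y)
    = w0 * schur lam (rcons (rcons U y) x) -> q.[x] = w0 * S y x / S0 y.
  move=> y0; rewrite rcons2 -cats1 -/(S0 _) -/(S _ _) => <-.
  by rewrite mulfK // S0_neq0.
have {}qaE x : qa.[x] = w0 * S a x / S0 a by apply: valE.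
have {}qbE x : qb.[x] = w0 * S b x / S0 b by apply: valE.
have {}qtE x : qt.[x] = w0 * S t x / S0 t by apply: valE.
pose F := (t - a) / (b - a) * ((S a t * S0 b) / (S a b * S0 t)).
have nz := (S_neq0 a b ha hb, S0_neq0 a ha, S0_neq0 b hb, S0_neq0 t ht).
have ba : b - a != 0 by rewrite subr_eq0 eq_sym.
(* Evaluation at a determines alpha. *)
have iff_F al : pt = (1 - al) *: pa + al *: pb <-> al = F.
  rewrite (pseudo_affinityP hlam size_U U_gt0 al ha ht pt_val Ea Eb Et).
  rewrite qtE qbE (SC t a) (SC b a).
  have -> : (a - t) * (w0 * S a t / S0 t) =
      F * ((a - b) * (w0 * S a b / S0 b)).
    by rewrite /F; field; rewrite !nz ba.
  split=> [/esym|-> //]; apply: mulIf; rewrite !mulf_neq0 ?invr_eq0 ?nz //.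
  by rewrite subr_eq0.
have factorF : is_pseudo_affinity_factor n lam U a b t F.
  exists pa, pb, pt; split=> //; apply/seteqP.
  by split=> al /=; rewrite iff_F.
have -> : pseudo_affinity_factor n lam U a b t = F.
  apply: xget_unique => // al [pa' [pb' [pt' [pa'E pb'E pt'E alE]]]].
  rewrite (blossom_unique pa_val pa'E) (blossom_unique pb_val pb'E) in alE.
  rewrite (blossom_unique pt_val pt'E) in alE.
  by apply/esym; have /seteqP[+ _] := alE; apply; apply/iff_F.
split=> //.
(* Exchanging a and b exchanges alpha and 1 - alpha. *)
have : pt = (1 - (1 - F)) *: pb + (1 - F) *: pa.
  by rewrite subKr addrC; apply/iff_F.
rewrite (pseudo_affinityP hlam size_U U_gt0 (1 - F) hb ht pt_val Eb Ea Et).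
rewrite qtE qaE (SC t b) -/(S b t) -/(S a b) -/(S0 a) -/(S0 t).
have -> : (b - t) * (w0 * S b t / S0 t)
    = ((b - t) / (b - a) * ((S b t * S0 a) / (S a b * S0 t)))
      * ((b - a) * (w0 * S a b / S0 a)).
  by field; rewrite !nz ba.
by move=> /esym; apply: mulIf; rewrite !mulf_neq0 ?invr_eq0 ?nz.
Qed.
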